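(* For all integers $n>1$ and $k$ with $1\le k\le n$, the number $S_k(n)$ is not an integer.
   Context: For positive integers $n$ and $k\le n$, $S_k(n)$ denotes the $k$-th elementary symmetric function of $1,1/3,\dots,1/(2n-1)$, i.e. $S_k(n)=\sum_{0\le i_1<\dots<i_k\le n-1}\prod_{j=1}^k \frac{1}{1+2i_j}$. *)

(* Defs.v *)
From HB Require Import structures.
From mathcomp Require Import all_boot all_order all_algebra.
From mathcomp Require mpoly.
Set Implicit Arguments.
Unset Strict Implicit.
Unset Printing Implicit Defensive.
Import Order.TTheory GRing.Theory Num.Theory.
Local Open Scope ring_scope.

(* The tuples t = (i_1, ..., i_k) with 0 <= i_1 < ... < i_k <= n - 1. *)
Definition esym_odd_recip (k n : nat) : rat :=
  \sum_(t : k.-tuple 'I_n | sorted ltn [seq val i | i <- t])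
     \prod_(j < k) ((1 + 2 * tnth t j)%N%:R)^-1.

Lemma esym_odd_recip_mesym (k n : nat) :
  esym_odd_recip k n =
  mpoly.meval (fun i : 'I_n => ((1 + 2 * i)%N%:R : rat)^-1)
    (mpoly.mesym n rat k).
Proof.
set v := fun i : 'I_n => _.
rewrite mpoly.mesym_tupleE (big_morph (mpoly.meval v) (mpoly.mevalD v) (mpoly.meval0 v)).
apply: eq_bigr => t _.
rewrite (big_morph (mpoly.meval v) (mpoly.mevalM v) (mpoly.meval1 v)) big_tuple.
by apply: eq_bigr => j _; rewrite mpoly.mevalXU.
Qed.

(* Main.v *)
From Stdlib Require Import NArith.
Require Import Defs.
From mathcomp Require Import all_boot all_order all_algebra.
From mathcomp Require mpoly.
From mathcomp Require Import zify ring.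
Set Implicit Arguments.
Unset Strict Implicit.
Unset Printing Implicit Defensive.
Import Order.TTheory GRing.Theory Num.Theory.
Local Open Scope ring_scope.

(* Let c(n, k) be the coefficient of X^k in (X + 1)(X + 3)...(X + 2n - 1), so
   that S_k(n) = c(n, k) / c(n, 0), and suppose that c(n, 0) divides c(n, k).
   - Let p be an odd prime with m >= k odd multiples below 2n. Splitting off the
     factors divisible by p shows that p divides c(m, k).
   - At X = 2 the product telescopes to (2n + 1) c(n, 0), whence
     2^k <= 2n + 1: k is at most logarithmic in n.
   - Put N = n / 2k. Every prime in (N/2, 2N] has m in [k, 4k], so the product of
     these primes divides the product of the c(m, k) over this range, which is
     at most (4k)^(9k^2 + 3k). But by Chebyshev's argument (factor the binomial
     coefficient C(2N, N), and bound the primes up to N/2 by 4^(N/2)) the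
     product of these primes grows exponentially in N: impossible for large n.
   - Since c(k, k) = 1 and c(k+1, k) = (k+1)^2, a single prime p > k + 1 with m
     equal to k or k + 1 is already contradictory. Explicit primes settle in this
     way all the remaining n and k but some with n < 72, checked directly. *)

(** * The criterion for one prime *)

Definition linprod (a : nat -> nat) (n : nat) : {poly nat} :=
  \prod_(i < n) ('X + (a i)%:P).

Definition lincoef (a : nat -> nat) (n k : nat) : nat := ((linprod a n)`_k)%R.

Lemma linprodS a n : linprod a n.+1 = linprod a n * ('X + (a n)%:P).
Proof. by rewrite /linprod big_ord_recr. Qed.

Lemma lincoef0n a k : lincoef a 0 k = (k == 0%N).
Proof. by rewrite /lincoef /linprod big_ord0 coef1; case: k. Qed.

Lemma lincoefn0 a n : lincoef a n 0 = (\prod_(i < n) a i)%N.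
Proof.
rewrite /lincoef /linprod coef0_prod.
by apply: eq_bigr => i _; rewrite coefD coefX coefC add0r.
Qed.

Lemma lincoefSS a n k :
  lincoef a n.+1 k.+1 = (lincoef a n k + a n * lincoef a n k.+1)%N.
Proof. by rewrite /lincoef linprodS mulrDr coefD coefMX coefMC /= mulrC. Qed.

Lemma lincoefS0 a n : lincoef a n.+1 0 = (a n * lincoef a n 0)%N.
Proof. by rewrite /lincoef linprodS mulrDr coefD coefMX coefMC /= add0r mulrC. Qed.

(** The coefficient is homogeneous of degree [n - k] in the [a i]; the factor [p ^ k] avoids a
    truncated subtraction when [k > n]. *)
Lemma lincoef_scale a p n k :
  (lincoef (fun i => p * a i) n k * p ^ k = p ^ n * lincoef a n k)%N.
Proof.
elim: n k => [|n IHn] k; first by rewrite !lincoef0n; case: k.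
case: k => [|k].
  have := IHn 0%N; rewrite !lincoefS0 expn0 !muln1 -mulnA => ->.
  by rewrite expnS; ring.
rewrite !lincoefSS mulnDl [in RHS]mulnDr; congr (_ + _)%N.
  by rewrite [(p ^ k.+1)%N]expnS mulnCA IHn expnS mulnA.
by rewrite -mulnA IHn expnS; ring.
Qed.

(** When the product is expanded, [J] is the set of factors that contribute ['X]. *)
Lemma lincoefE a n k :
  lincoef a n k = (\sum_(J : {set 'I_n} | #|J| == k) \prod_(i in ~: J) a i)%N.
Proof.
rewrite /lincoef /linprod bigA_distr coef_sum [RHS]big_mkcond.
apply: eq_bigr => J _.
rewrite (bigID (mem J)) /= (eq_bigr (fun=> 'X)) => [|i ->//].
rewrite prodr_const [X in _ * X](eq_bigr (fun i : 'I_n => (a i)%:P)).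
  rewrite -rmorph_prod coefMC coefXn eq_sym.
  rewrite (eq_bigl (mem (~: J))) => [|i]; last by rewrite !inE.
  by case: eqP; rewrite ?mul1r ?mul0r.
by move=> i /negbTE ->.
Qed.

Definition oddcoef : nat -> nat -> nat := lincoef (fun i => 1 + 2 * i)%N.

Lemma esym_odd_recipE k n :
  esym_odd_recip k n * (oddcoef n 0)%:R = (oddcoef n k)%:R.
Proof.
rewrite esym_odd_recip_mesym /mpoly.mesym /oddcoef lincoefn0 lincoefE.
set v := fun i : 'I_n => _.
rewrite (big_morph (mpoly.meval v) (mpoly.mevalD v) (mpoly.meval0 v)).
rewrite mulr_suml natr_sum; apply: eq_bigr => J _.
rewrite (big_morph (mpoly.meval v) (mpoly.mevalM v) (mpoly.meval1 v)).
rewrite !natr_prod [X in _ * X](bigID (mem J)) /= mulrA.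
rewrite (eq_bigr v) => [|i _]; last by rewrite mpoly.mevalXU.
rewrite [X in _ * X * _](eq_bigl (mem J)) => [|i]; last by rewrite !inE.
rewrite -big_split /= big1 ?mul1r => [|i _]; last first.
  by rewrite mulVf // pnatr_eq0.
by apply: eq_bigl => i; rewrite !inE.
Qed.

Lemma esym_odd_recip_int k n :
  esym_odd_recip k n \is a Num.int -> (oddcoef n 0 %| oddcoef n k)%N.
Proof.
move=> /intrP[z Sz]; have := esym_odd_recipE k n.
rewrite Sz !pmulrn -intrM => /eqP.
rewrite eqr_int => /eqP /(congr1 absz); rewrite abszM !absz_nat => <-.
exact: dvdn_mull.
Qed.

(** As [p = 2h + 1], the condition [p (1 + 2j) < 2n] amounts to [p (j + 1) <= n + h]; hence the
    number of factors on the right. *)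
Lemma prod_multiples (R : comNzSemiRingType) (F : nat -> R) n h
    (p := (2 * h + 1)%N) :
  \prod_(i < n | (p %| 1 + 2 * i)%N) F (1 + 2 * i)%N =
  \prod_(j < (n + h) %/ p) F (p * (1 + 2 * j))%N.
Proof.
have p_gt0 : (0 < p)%N by rewrite /p; lia.
elim: n => [|n IHn].
  by rewrite divn_small ?big_ord0 // /p; lia.
rewrite big_mkcond big_ord_recr -big_mkcond /= IHn [(n.+1 + h)%N]addSn divnS //.
have -> : (p %| (n + h).+1)%N = (p %| 1 + 2 * n)%N.
  rewrite -(@Gauss_dvdr _ 2) ?coprimen2; last by rewrite /p; lia.
  have -> : (2 * (n + h).+1 = p + (1 + 2 * n))%N by rewrite /p; lia.
  by rewrite dvdn_addr.
case: ifP => [/dvdnP[q Dq]|_]; last by rewrite mulr1 add0n.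
rewrite -[(true + _)%N]/(((n + h) %/ p).+1) big_ord_recr /=; congr (_ * F _).
have q_odd : odd q by move/(congr1 odd): Dq; rewrite oddM /p; lia.
have -> : ((n + h) %/ p = q./2)%N; last by rewrite Dq mulnC; congr (_ * _)%N; lia.
have -> : (n + h = q./2 * p + 2 * h)%N.
  have : (1 + 2 * n = (q./2.*2.+1) * p)%N.
    by rewrite Dq; congr (_ * _)%N; lia.
  by rewrite /p; nia.
by rewrite divnMDl // divn_small ?addn0 // /p; lia.
Qed.

(* The factors ['X + (1 + 2 * i)] with [p %| 1 + 2 * i] form a rescaled copy of
   the product of length [m], and the other ones have a constant term prime to
   [p]; so modulo [p ^ (m - k + 1)] the coefficient of ['X^k] is [p ^ (m - k)]
   times that of the product of length [m], up to a unit. *)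
Lemma dvdn_oddcoef n k h (p := (2 * h + 1)%N) (m := ((n + h) %/ p)%N) :
  prime p -> (0 < k <= m)%N -> (oddcoef n 0 %| oddcoef n k)%N ->
  (p %| oddcoef m k)%N.
Proof.
move=> p_pr /andP[k_gt0 le_km].
have p_gt0 := prime_gt0 p_pr.
pose Q : {poly nat} :=
  \prod_(i < n | ~~ (p %| 1 + 2 * i)%N) ('X + (1 + 2 * i)%N%:P).
pose R := linprod (fun j => p * (1 + 2 * j))%N m.
have DP : linprod (fun i => 1 + 2 * i)%N n = R * Q.
  rewrite /linprod (bigID (fun i : 'I_n => p %| 1 + 2 * i)%N) /=.
  by rewrite (prod_multiples (fun x => 'X + x%:P : {poly nat})).
have coefR i : (i <= m)%N -> R`_i = (p ^ (m - i) * oddcoef m i)%N.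
  move=> le_im; apply/eqP; rewrite -(@eqn_pmul2r (p ^ i)) ?expn_gt0 ?p_gt0 //.
  rewrite mulnAC -expnD subnK // /oddcoef.
  by rewrite -lincoef_scale.
have coQ : coprime p (Q`_0)%R.
  rewrite /Q coef0_prod.
  apply: (big_ind (fun x : nat => coprime p x)) => [|x y cx cy|i pNi].
  - exact: coprimen1.
  - by rewrite coprimeMr cx.
  by rewrite coefD coefX coefC /= add0r prime_coprime.
(* As [k > 0], the [m] factors [p] of the constant term include the [m - k + 1] needed here. *)
have dvdD : (p ^ (m - k).+1 %| oddcoef n 0)%N.
  rewrite /oddcoef /lincoef DP coef0M coefR // subn0.
  apply: dvdn_mulr; apply: dvdn_mulr; rewrite dvdn_exp2l //; lia.
move=> /(dvdn_trans dvdD).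
rewrite {1}/oddcoef {1}/lincoef DP coefM big_ord_recr /= subnn dvdn_addr; last first.
  apply: (big_ind (fun x : nat => p ^ (m - k).+1 %| x)%N) => [|x y dx dy|i _].
  - exact: dvdn0.
  - exact: dvdn_add.
  apply: dvdn_mulr; rewrite coefR; last by have := ltn_ord i; lia.
  by apply: dvdn_mulr; rewrite dvdn_exp2l //; have := ltn_ord i; lia.
rewrite coefR // -[X in (_ %| X)%N]mulnA expnSr dvdn_pmul2l ?expn_gt0 ?p_gt0 //.
by rewrite Gauss_dvdl.
Qed.

(** * Bounds on the coefficients *)

Lemma oddcoef_gt0 n k : (k <= n)%N -> (0 < oddcoef n k)%N.
Proof.
elim: n k => [|n IHn] [|k] le_kn //; rewrite /oddcoef ?lincoef0n //.
  by rewrite lincoefS0 muln_gt0 IHn.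
by rewrite lincoefSS addn_gt0 IHn.
Qed.

Lemma oddcoef_big n k : (n < k)%N -> oddcoef n k = 0%N.
Proof.
elim: n k => [|n IHn] [|k] // lt_nk; rewrite /oddcoef ?lincoef0n //.
by rewrite lincoefSS -!/(oddcoef _ _) !IHn ?muln0 // ltnW.
Qed.

Lemma oddcoef_diag n : oddcoef n n = 1%N.
Proof.
elim: n => [|n IHn]; rewrite /oddcoef ?lincoef0n //.
by rewrite lincoefSS -!/(oddcoef _ _) IHn oddcoef_big ?muln0.
Qed.

Lemma oddcoef_subdiag n : oddcoef n.+1 n = (n.+1 ^ 2)%N.
Proof.
elim: n => [|n IHn]; first by rewrite /oddcoef lincoefS0 lincoef0n.
rewrite /oddcoef lincoefSS -!/(oddcoef _ _) IHn oddcoef_diag; lia.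
Qed.

Lemma oddcoef_le_exp n k : (k <= n)%N -> (oddcoef n k <= (n ^ 2) ^ (n - k))%N.
Proof.
elim: n k => [|n IHn] [|k] le_kn; rewrite /oddcoef ?lincoef0n //.
  have [->|n_gt0] := posnP n; first by rewrite lincoefS0 lincoef0n.
  rewrite lincoefS0 -/(oddcoef _ _) subn0 expnS.
  apply: leq_mul; first by lia.
  apply: leq_trans (IHn 0%N isT) _.
  by rewrite subn0 leq_exp2r // leq_sqr.
rewrite lincoefSS -!/(oddcoef _ _) subSS.
have [->|ne_kn] := eqVneq k n.
  by rewrite oddcoef_diag oddcoef_big // subnn muln0.
have lt_kn : (k < n)%N by lia.
have -> : (n - k = (n - k.+1).+1)%N by lia.
(* The identity [n ^ 2 + (2n + 1) = (n + 1) ^ 2] merges the two terms of the recurrence. *)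
apply: (@leq_trans (n.+1 ^ 2 * (n ^ 2) ^ (n - k.+1))).
  have := IHn k le_kn; have := IHn k.+1 lt_kn.
  have -> : (n - k = (n - k.+1).+1)%N by lia.
  rewrite [((n ^ 2) ^ _.+1)%N]expnS; move: (expn _ (n - k.+1)) (oddcoef n k) (oddcoef n k.+1) => e x y.
  by rewrite -!mulnn; nia.
rewrite [leqRHS]expnS leq_mul2l; case: (n - k.+1)%N => [|e].
  by rewrite !expn0 leqnn orbT.
by rewrite leq_exp2r // leq_sqr leqnSn orbT.
Qed.

(** This bounds one term of the product at [X = 2]. The induction closes since [2 + (2n + 1)] is the
    next factor [2n + 3]. *)
Lemma oddcoef_exp2_le n k : (oddcoef n k * 2 ^ k <= (2 * n + 1) * oddcoef n 0)%N.
Proof.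
elim: n k => [|n IHn] [|k]; rewrite /oddcoef ?lincoef0n ?expn0 ?muln1 //.
  by rewrite leq_pmull // addn1.
rewrite lincoefSS lincoefS0 -!/(oddcoef _ _).
by have := IHn k; have := IHn k.+1; rewrite expnS; nia.
Qed.

Lemma exp2_le_of_dvd n k : (k <= n)%N -> (oddcoef n 0 %| oddcoef n k)%N ->
  (2 ^ k <= 2 * n + 1)%N.
Proof.
move=> le_kn /(dvdn_leq (oddcoef_gt0 le_kn)) le0k.
rewrite -(@leq_pmul2l (oddcoef n 0)) ?oddcoef_gt0 //.
apply: leq_trans (leq_mul le0k (leqnn _)) _.
by rewrite [X in (_ <= X)%N]mulnC oddcoef_exp2_le.
Qed.

(** * Chebyshev estimates *)

Lemma dvdn_prod_primes a b C :
  (forall p, (a <= p < b)%N -> prime p -> (p %| C)%N) ->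
  (\prod_(a <= p < b | prime p) p %| C)%N.
Proof.
elim: b => [|b IHb] dvdC; first by rewrite big_geq ?dvd1n.
have [lt_ba|le_ab] := ltnP b a; first by rewrite big_geq ?dvd1n.
rewrite big_mkcond big_nat_recr //= -big_mkcond /=.
have IH : (\prod_(a <= p < b | prime p) p %| C)%N.
  by apply: IHb => p /andP[? ?]; apply: dvdC; apply/andP; split=> //; apply: leqW.
case: ifP => [b_pr|_]; last by rewrite muln1.
rewrite Gauss_dvd ?IH ?dvdC ?le_ab ?leqnn //.
rewrite coprime_sym big_nat_cond.
apply: (big_ind (fun x => coprime b x)) => [|x y cx cy|p /andP[/andP[_ lt_pb] p_pr]].
- exact: coprimen1.
- by rewrite coprimeMr cx.
by rewrite prime_coprime // dvdn_prime2 // eq_sym neq_ltn lt_pb.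
Qed.

Lemma prime_dvd_fact p n : prime p -> (p %| n`!)%N = (p <= n)%N.
Proof.
move=> p_pr; apply/idP/idP; last by move=> ?; rewrite dvdn_fact ?prime_gt0.
elim: n => [|n IHn]; first by rewrite dvdn1; case: eqP p_pr => // ->.
rewrite factS Euclid_dvdM // => /orP[/dvdn_leq->//|/IHn]; exact: leqW.
Qed.

Lemma bin_centralS n :
  (n.+1 * 'C(2 * n.+1, n.+1) = 2 * (2 * n + 1) * 'C(2 * n, n))%N.
Proof.
have -> : (2 * n.+1 = (2 * n + 1).+1)%N by lia.
rewrite binS -(@bin_sub _ n); last by lia.
have -> : (2 * n + 1 - n = n.+1)%N by lia.
have := mul_bin_diag (2 * n).+1 n; rewrite /= addn1; nia.
Qed.

Lemma bin_central_ge n : (0 < n)%N -> (4 ^ n <= 2 * n * 'C(2 * n, n))%N.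
Proof.
elim: n => // -[|n] IHn _ //.
have := IHn isT; have := bin_centralS n.+1; rewrite [in (4 ^ n.+2)%N]expnS.
by move: (4 ^ _)%N 'C(_, _) 'C(_, _) => x y z; nia.
Qed.

Lemma bin_central_le n : (0 < n)%N -> (2 * 'C(2 * n, n) <= 4 ^ n)%N.
Proof.
elim: n => // -[|n] IHn _ //.
have := IHn isT; have := bin_centralS n.+1; rewrite [in (4 ^ n.+2)%N]expnS.
by move: (4 ^ _)%N 'C(_, _) 'C(_, _) => x y z; nia.
Qed.

(** By Pascal's rule and symmetry, this is half of ['C(2n + 2, n + 1)]. *)
Lemma bin_odd_central_le n : ('C(2 * n + 1, n) <= 4 ^ n)%N.
Proof.
have := bin_central_le (ltn0Sn n); have -> : (2 * n.+1 = (2 * n + 1).+1)%N by lia.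
rewrite binS -(@bin_sub _ n); last by lia.
have -> : (2 * n + 1 - n = n.+1)%N by lia.
rewrite expnS; lia.
Qed.

(** Erdős's induction: the primes in (m + 1, 2m + 1] divide ['C(2m + 1, m)], and an even number
    above 2 adds no prime. *)
Lemma primorial_le n : (\prod_(0 <= p < n.+1 | prime p) p <= 4 ^ n)%N.
Proof.
elim/ltn_ind: n => -[|[|[|n]]] IHn; try by rewrite !big_mkcond unlock.
(* The bound is now [n.+3], of parity opposite to that of [n]. *)
have [n_odd|n_even] := boolP (odd n); last first.
  have [m Dn] : exists m, n.+2 = (2 * m)%N by exists (n./2).+1; lia.
  rewrite (@big_cat_nat _ _ _ m.+2) //=; last by lia.
  apply: (@leq_trans (4 ^ m.+1 * 'C(2 * m + 1, m))); last first.
    rewrite Dn -addn1 mulnC (@leq_trans (4 ^ m * 4 ^ m.+1)) //.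
      by rewrite leq_mul2r bin_odd_central_le orbT.
    by rewrite -expnD leq_exp2l //; lia.
  apply: leq_mul; first by apply: IHn; lia.
  apply: dvdn_leq; first by rewrite bin_gt0; lia.
  apply: dvdn_prod_primes => p lt_p p_pr.
  have le_m : (m <= 2 * m + 1)%N by lia.
  have : (p %| (2 * m + 1)`!)%N by rewrite prime_dvd_fact //; lia.
  rewrite -(bin_fact le_m) !Euclid_dvdM // !prime_dvd_fact //.
  by case/or3P => //; lia.
rewrite big_mkcond big_nat_recr //= -big_mkcond ifN ?muln1.
  by apply: leq_trans (IHn _ _) _; rewrite ?leq_exp2l.
by apply/negP => /even_prime[|]; lia.
Qed.

(** By Legendre's formula the exponent is the sum of [2n %/ p ^ k - 2 (n %/ p ^ k)]; each term is 0
    or 1, and vanishes once [p ^ k > 2n]. *)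
Lemma pfactor_bin_central_le p n : prime p -> (0 < n)%N ->
  (p ^ logn p 'C(2 * n, n) <= 2 * n)%N.
Proof.
move=> p_pr n_gt0; have p_gt1 := prime_gt1 p_pr.
have [T leT ltT] : exists2 T, (p ^ T <= 2 * n)%N & (2 * n < p ^ T.+1)%N.
  have n2 : (0 < 2 * n)%N by lia.
  by exists (trunc_log p (2 * n)); have /andP[] := trunc_log_bounds p_gt1 n2.
apply: leq_trans leT; rewrite leq_exp2l //.
have le_n : (n <= 2 * n)%N by lia.
have /(congr1 (logn p)) := bin_fact le_n.
have -> : (2 * n - n = n)%N by lia.
rewrite !lognM ?muln_gt0 ?fact_gt0 ?bin_gt0 // !logn_fact //.
have -> : (\sum_(1 <= k < n.+1) n %/ p ^ k = \sum_(1 <= k < (2 * n).+1) n %/ p ^ k)%N.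
  rewrite [RHS](@big_cat_nat _ _ _ n.+1) //= [X in (_ + X)%N]big_nat_cond.
  rewrite [X in (_ + X)%N]big1 ?addn0 // => k /andP[/andP[lt_nk _] _].
  by rewrite divn_small // (leq_trans lt_nk) // ltnW // ltn_expl.
have : (\sum_(1 <= k < (2 * n).+1) 2 * n %/ p ^ k <=
   \sum_(1 <= k < (2 * n).+1) (n %/ p ^ k + n %/ p ^ k + (k <= T)))%N.
  apply: leq_sum => k _; have pk_gt0 : (0 < p ^ k)%N by rewrite expn_gt0 ltnW.
  have [le_kT|lt_Tk] := leqP k T.
    rewrite -ltnS ltn_divLR // addn1 addnn.
    by have := divn_eq n (p ^ k); have := ltn_pmod n pk_gt0; nia.
  by rewrite divn_small // (leq_trans ltT) // leq_exp2l.
rewrite !big_split /=.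
have : (\sum_(1 <= k < (2 * n).+1) (k <= T) <= T)%N.
  elim: (2 * n)%N => [|m IHm]; first by rewrite big_geq.
  rewrite big_nat_recr //=; case: (leqP m.+1 T) => [le_mT|_]; last by rewrite addn0.
  apply: leq_trans le_mT; rewrite addn1 ltnS.
  apply: (@leq_trans (\sum_(1 <= k < m.+1) 1)).
    by apply: leq_sum => k _; exact: leq_b1.
  by rewrite sum_nat_const_nat subSS subn0 muln1.
lia.
Qed.

(** Each index up to [s] contributes at most [2n]; a prime above [s] has its square above [2n], so
    it occurs at most once. *)
Lemma bin_central_le_primes n s : (0 < n)%N -> (2 * n < s.+1 ^ 2)%N -> (s <= 2 * n)%N ->
  ('C(2 * n, n) <= (2 * n) ^ s.+1 * \prod_(s.+1 <= p < (2 * n).+1 | prime p) p)%N.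
Proof.
move=> n_gt0 lt_n les; set B := 'C(_, _).
have B_gt0 : (0 < B)%N by rewrite bin_gt0; lia.
(* The range is widened to [B + 2n] so that it can be split at [2n + 1]. *)
rewrite -[leqLHS]partnT // (widen_partn _ (leq_addr (2 * n) B)).
rewrite (@big_cat_nat _ _ _ (2 * n).+1) //=; last by lia.
rewrite [X in (_ * X)%N]big_nat_cond [X in (_ * X)%N]big1 ?muln1; last first.
  move=> p /andP[/andP[lt_np _] _].
  have [p_pr|/negbTE p_npr] := boolP (prime p); last by rewrite lognE p_npr.
  case: logn (pfactor_bin_central_le p_pr n_gt0) => // e.
  by rewrite expnS leqNgt (leq_trans lt_np) // leq_pmulr // expn_gt0 prime_gt0.
rewrite (@big_cat_nat _ _ _ s.+1) //=.
apply: leq_mul.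
  rewrite -[in leqRHS](subn0 s.+1) -prod_nat_const_nat; apply: leq_prod => p _.
  have [p_pr|/negbTE p_npr] := boolP (prime p); last by rewrite lognE p_npr muln_gt0.
  exact: pfactor_bin_central_le.
rewrite [leqRHS]big_mkcond big_nat_cond [leqRHS]big_nat_cond; apply: leq_prod => p.
move=> /andP[/andP[lt_sp _] _].
have [p_pr|/negbTE p_npr] := boolP (prime p); last by rewrite lognE p_npr.
rewrite -[leqRHS]expn1 leq_exp2l ?prime_gt1 // -ltnS.
rewrite -(ltn_exp2l _ _ (prime_gt1 p_pr)).
apply: leq_ltn_trans (pfactor_bin_central_le p_pr n_gt0) _.
by apply: leq_trans lt_n _; rewrite leq_sqr.
Qed.
(** * Large n *)

Lemma sqrtn_exists n : exists s, (s ^ 2 <= n < s.+1 ^ 2)%N.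
Proof.
elim: n => [|n [s /andP[le_sn lt_ns]]]; first by exists 0%N.
have [lt_ns'|le_sn'] := ltnP n.+1 (s.+1 ^ 2).
  by exists s; rewrite lt_ns' leqW.
by exists s.+1; rewrite le_sn'; move: lt_ns; rewrite -!mulnn; lia.
Qed.

(** The threshold is sharp: at [q = 12], 65^2 = 4225 exceeds 2^12 = 4096. *)
Lemma exp2_ge_square q : (13 <= q)%N -> ((5 * q + 5) ^ 2 <= 2 ^ q)%N.
Proof.
elim: q => // q IHq; rewrite leq_eqVlt => /predU1P[<- //|lt_q].
have := IHq lt_q; rewrite [(2 ^ q.+1)%N]expnS -!mulnn.
by move: (2 ^ q)%N => x; nia.
Qed.

(** From [n >= 2113] follows [2n > 65 ^ 2], so [q = s %/ 5] is at least 13 and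
    [2n < (5q + 5) ^ 2 <= 2 ^ q]. Then [q (s + 2)] is at most about [2n / 5], which leaves room
    below [n / 2]. *)
Lemma exp_sqrt_le n s : (2113 <= n)%N -> (s ^ 2 <= 2 * n < s.+1 ^ 2)%N ->
  ((2 * n) ^ s.+2 <= 2 ^ n./2)%N.
Proof.
rewrite -!mulnn => le_n /andP[le_sn lt_ns].
have s_ge : (65 <= s)%N by nia.
pose q := (s %/ 5)%N.
have [le_q lt_q] : (5 * q <= s /\ s < 5 * q + 5)%N.
  by have := divn_eq s 5; have := ltn_pmod s (isT : 0 < 5)%N; rewrite -/q; lia.
have le_2n : (2 * n <= 2 ^ q)%N.
  have q_ge : (13 <= q)%N by lia.
  by have := exp2_ge_square q_ge; rewrite -mulnn; nia.
apply: (@leq_trans ((2 ^ q) ^ s.+2)); first by rewrite leq_exp2r.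
rewrite -expnM leq_exp2l //.
have : (5 * (q * s.+2) <= s * s.+2)%N by rewrite mulnA leq_mul2r le_q orbT.
have : (n <= n./2.*2.+1)%N by lia.
nia.
Qed.

Lemma prod_oddcoef_le k t : (4 * k <= 2 ^ t)%N ->
  (\prod_(k <= m < (4 * k).+1) oddcoef m k <= 2 ^ (t * (9 * k ^ 2 + 3 * k)))%N.
Proof.
(* The factor of index [k + i] is at most [2 ^ (2 t i)], and these exponents sum to [t j (j - 1)];
   [j = 3k + 1] gives the claim. *)
move=> le_k; suff bnd j : (k + j <= (4 * k).+1)%N ->
    (\prod_(k <= m < k + j) oddcoef m k <= 2 ^ (t * (j * j.-1)))%N.
  have -> : (4 * k).+1 = (k + (3 * k).+1)%N by lia.
  apply: leq_trans (bnd _ _) _; first by lia.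
  by rewrite leq_exp2l // leq_mul2l -mulnn; apply/orP; right; lia.
elim: j => [|j IHj] le_j; first by rewrite addn0 big_geq ?expn_gt0.
rewrite addnS big_nat_recr ?leq_addr //=.
apply: leq_trans (leq_mul (IHj _) (oddcoef_le_exp (leq_addr _ _))) _; first by lia.
rewrite addKn; apply: (@leq_trans (2 ^ (t * (j * j.-1)) * ((2 ^ t) ^ 2) ^ j)).
  rewrite leq_mul2l; case: j le_j {IHj} => [|j] le_j; first by rewrite !expn0 orbT.
  by rewrite leq_exp2r // leq_sqr; apply/orP; right; lia.
by rewrite -!expnM -expnD leq_exp2l //; case: j {IHj le_j} => [|j] /=; nia.
Qed.

(* A prime [p] with [n / 4k < p <= 2 * (n / 2k)] has between [k] and [4 * k] odd
   multiples below [2 * n]. *)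
Lemma dvdn_prod_oddcoef n k p : (0 < k)%N -> (8 * k <= n)%N -> prime p ->
    (oddcoef n 0 %| oddcoef n k)%N ->
    ((n %/ (2 * k))./2 < p <= 2 * (n %/ (2 * k)))%N ->
  (p %| \prod_(k <= m < (4 * k).+1) oddcoef m k)%N.
Proof.
move=> k_gt0 le_8k p_pr dvd_n; set N := (n %/ (2 * k))%N => /andP[lt_p le_p].
have N_ge : (4 <= N)%N by rewrite leq_divRL; lia.
have p_odd : odd p by case: (even_prime p_pr) => // Dp; move: lt_p; rewrite Dp; lia.
have Dp : p = (2 * p./2 + 1)%N by lia.
have [le_N lt_N] : (N * (2 * k) <= n /\ n < N.+1 * (2 * k))%N.
  by split; [rewrite leq_divM | rewrite -ltn_divLR ?muln_gt0].
pose m := ((n + p./2) %/ p)%N; have p_gt0 := prime_gt0 p_pr.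
(* The bound [p <= 2N] gives [k p <= n], and [N + 1 <= 2p] gives [n < 4k p]. *)
have le_km : (k <= m)%N by rewrite leq_divRL //; nia.
have le_mk : (m < (4 * k).+1)%N by rewrite ltn_divLR //; nia.
have m_in : m \in index_iota k (4 * k).+1 by rewrite mem_index_iota le_km.
rewrite (bigD1_seq m) ?iota_uniq //= dvdn_mulr //.
have := @dvdn_oddcoef n k p./2; rewrite -Dp -/m; apply=> //.
by rewrite k_gt0.
Qed.

(** Divisibility would bound [4 ^ N] by [2 ^ (N / 2) * 4 ^ (N / 2) * 2 ^ E], whereas [2E < N]. The
    three factors come from the primes up to the square root of [2N], those up to [N / 2], and the
    remaining ones. *)
Lemma not_dvdn_oddcoef_large n k t (N := (n %/ (2 * k))%N) : (0 < k)%N ->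
    (4 * k <= 2 ^ t)%N -> (2113 <= N)%N -> (2 * (t * (9 * k ^ 2 + 3 * k)) < N)%N ->
  ~~ (oddcoef n 0 %| oddcoef n k)%N.
Proof.
move=> k_gt0 le_t N_ge; set E := (t * _)%N => ltEN; apply/negP => dvd_n.
have N_gt0 : (0 < N)%N by lia.
have [s s_sqrt] := sqrtn_exists (2 * N)%N; have [le_s lt_s] := andP s_sqrt.
have s_ge : (65 <= s)%N by move: lt_s N_ge; rewrite -mulnn; clear; nia.
have le_sN : (s <= N./2)%N by move: le_s; rewrite -mulnn; nia.
have := bin_central_ge N_gt0; apply/negP; rewrite -ltnNge.
have le_s2N : (s <= 2 * N)%N by lia.
have := bin_central_le_primes N_gt0 lt_s le_s2N.
set P := (\prod_(_ <= p < _ | _) _)%N => le_binP.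
have leP : (P <= 4 ^ N./2 * 2 ^ E)%N.
  rewrite /P (@big_cat_nat _ _ _ N./2.+1) //=; last by lia.
  apply: leq_mul.
    apply: leq_trans (primorial_le _).
    rewrite [leqRHS](@big_cat_nat _ _ _ s.+1) //= leq_pmull //.
    by rewrite prodn_cond_gt0 // => p /prime_gt0.
  apply: leq_trans (prod_oddcoef_le le_t).
  apply: dvdn_leq.
    by rewrite big_nat_cond prodn_cond_gt0 // => m /andP[/andP[? _] _]; rewrite oddcoef_gt0.
  apply: dvdn_prod_primes => p p_bnd p_pr; apply: dvdn_prod_oddcoef p_bnd => //.
  by have := leq_divM n (2 * k); rewrite -/N; move: N_ge; clear; nia.
apply: (@leq_ltn_trans ((2 * N) ^ s.+2 * (4 ^ N./2 * 2 ^ E))).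
  rewrite [((2 * N) ^ _.+2)%N]expnS -[leqRHS]mulnA leq_mul2l; apply/orP; right.
  by apply: leq_trans le_binP _; rewrite leq_mul2l leP orbT.
apply: (@leq_ltn_trans (2 ^ N./2 * (4 ^ N./2 * 2 ^ E))).
  by rewrite leq_mul2r exp_sqrt_le ?orbT.
by rewrite -[4%N]/(2 ^ 2)%N -!expnM -!expnD ltn_exp2l //; lia.
Qed.

(** * The remaining pairs *)

Fixpoint no_odd_divisor (fuel : nat) (d p : N) : bool :=
  if fuel is f.+1 then
    (p <? d * d)%num || ~~ (p mod d =? 0)%num && no_odd_divisor f (d + 2)%num p
  else false.

(** With this fuel the trial divisors reach 401, whose square exceeds every entry of
    [chain_primes]. *)
Definition odd_primeN (p : N) : bool :=
  [&& (p mod 2 =? 1)%num, (1 <? p)%num & no_odd_divisor 200 3 p].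

Lemma no_odd_divisorP fuel d p q : no_odd_divisor fuel d p -> odd (N.to_nat d) ->
  odd q -> (N.to_nat d <= q)%N -> (q %| N.to_nat p)%N -> (N.to_nat p < q ^ 2)%N.
Proof.
elim: fuel d => //= f IHf d /orP[|/andP[dNp /IHf{IHf}IH]] d_odd q_odd le_dq q_p.
  by rewrite -mulnn; nia.
have [Dd|ne_dq] := eqVneq (N.to_nat d) q; last by apply: IH => //; lia.
case/negP: dNp; move: q_p; rewrite -Dd => /dvdnP[r Dp].
have -> : p = (N.of_nat r * d)%num by lia.
by rewrite N.Div0.mod_mul.
Qed.

Lemma odd_primeNP p : odd_primeN p -> odd (N.to_nat p) && prime (N.to_nat p).
Proof.
case/and3P=> p_odd p_gt1 p_div; have p_oddn : odd (N.to_nat p).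
  by have := N.div_mod' p 2; move/N.eqb_eq: p_odd => ->; lia.
have p_gt1n : (1 < N.to_nat p)%N by lia.
rewrite p_oddn /=; apply: ltn_pdiv2_prime; first by rewrite ltnW.
have pdiv_odd : odd (pdiv (N.to_nat p)) by apply: dvdn_odd p_oddn; apply: pdiv_dvd.
apply: (no_odd_divisorP p_div) => //; last exact: pdiv_dvd.
by have := prime_gt1 (pdiv_prime p_gt1n); move: pdiv_odd; case: pdiv => [|[|[]]].
Qed.

(* [ps] is scanned greedily, all integers of the initial interval below [lo]
   being already covered: a prime [p] covers [k * p <= n + p / 2 < (k + 2) * p]. *)
Fixpoint chain (k lo hi : N) (ps : seq N) : bool :=
  if ps isn't p :: ps' then (hi <=? lo)%num
  else if (k * p <=? lo + p / 2)%num && (k + 1 <? p)%num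
    then chain k (N.max lo ((k + 2) * p - p / 2)) hi ps'
    else chain k lo hi ps'.

(** The window on [n] forces [m] to be [k] or [k + 1], so [p] would divide 1 or [(k + 1) ^ 2]. *)
Lemma not_dvdn_oddcoef_prime n k p : (0 < k)%N -> odd p -> prime p ->
    (k.+1 < p)%N -> (k * p <= n + p./2 < k.+2 * p)%N ->
  ~~ (oddcoef n 0 %| oddcoef n k)%N.
Proof.
move=> k_gt0 p_odd p_pr lt_kp /andP[le_kn lt_nk]; apply/negP => dvd_n.
have Dp : p = (2 * p./2 + 1)%N by lia.
pose m := ((n + p./2) %/ p)%N.
have p_gt0 := prime_gt0 p_pr.
have le_km : (k <= m)%N by rewrite leq_divRL.
have lt_mk : (m < k.+2)%N by rewrite ltn_divLR.
have : (p %| oddcoef m k)%N.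
  by have := @dvdn_oddcoef n k p./2; rewrite -Dp -/m; apply=> //; rewrite k_gt0.
have [->|ne_mk] := eqVneq m k.
  by rewrite oddcoef_diag dvdn1 => /eqP Dp1; rewrite Dp1 in lt_kp.
have -> : m = k.+1 by lia.
by rewrite oddcoef_subdiag Euclid_dvdX // => /andP[/dvdn_leq-/(_ isT)]; lia.
Qed.

Lemma chainP k lo hi ps n : (0 < k)%num -> all odd_primeN ps -> chain k lo hi ps ->
    (N.to_nat lo <= n < N.to_nat hi)%N ->
  ~~ (oddcoef n 0 %| oddcoef n (N.to_nat k))%N.
Proof.
move=> k_gt0; elim: ps lo => [|p ps IHps] lo /=; first by lia.
case/andP=> /odd_primeNP/andP[p_odd p_pr] ps_pr.
case: ifP => [/andP[le_p lt_kp]|_]; last exact: IHps.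
move=> chain_ps /andP[le_lo lt_hi].
have [lt_n|le_n] := ltnP n (N.to_nat ((k + 2) * p - p / 2)).
  apply: (@not_dvdn_oddcoef_prime _ _ (N.to_nat p)) => //; try lia.
  have -> : (N.to_nat p)./2 = N.to_nat (p / 2).
    have := N.div_mod' p 2; have : (p mod 2 < 2)%num by apply: N.mod_lt.
    by move: (p mod 2)%num (p / 2)%num => r q; lia.
  move: (p / 2)%num le_p lt_n le_lo => h; nia.
by apply: IHps chain_ps _ => //; lia.
Qed.

(** Entry [k + 1] depends only on entries [k] and [k + 1] of the previous row, so truncated rows
    suffice; [zip] stops at the shorter list, which preserves the length. *)
Definition oddrow_step (a : N) (r : seq N) : seq N :=
  (a * head 0 r)%num :: [seq (x.1 + a * x.2)%num | x <- zip r (behead r)].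

(* Row [n] of [oddcoef], cut after the first eight entries. *)
Fixpoint oddrow (n : nat) : seq N :=
  if n is m.+1 then oddrow_step (1 + 2 * N.of_nat m) (oddrow m)
  else [:: 1; 0; 0; 0; 0; 0; 0; 0]%num.

Lemma size_oddrow n : size (oddrow n) = 8.
Proof.
elim: n => //= n IHn.
by rewrite size_map size_zip size_behead IHn.
Qed.

Lemma nth_oddrow n k : (k < 8)%N -> N.to_nat (nth 0%num (oddrow n) k) = oddcoef n k.
Proof.
elim: n k => [|n IHn] k lt_k.
  by rewrite /oddcoef lincoef0n; move: k lt_k; do 8?case.
have Da : N.to_nat (1 + 2 * N.of_nat n) = (1 + 2 * n)%N by lia.
have sz_r := size_oddrow n; move: IHn Da; rewrite /oddcoef.
rewrite -[oddrow n.+1]/(oddrow_step (1 + 2 * N.of_nat n) (oddrow n)).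
move: (1 + 2 * N.of_nat n)%num (oddrow n) sz_r => a r sz_r IHn Da.
case: k lt_k => [|k] lt_k.
  by rewrite lincoefS0 -Da -IHn //= nth0 N2Nat.inj_mul.
rewrite lincoefSS -Da -!IHn ?(ltnW lt_k) //=.
have sz_z : size (zip r (behead r)) = 7%N by rewrite size_zip size_behead sz_r.
rewrite (nth_map (0, 0)%num) ?sz_z // nth_zip_cond sz_z -ltnS lt_k /= nth_behead.
by rewrite N2Nat.inj_add N2Nat.inj_mul.
Qed.

(* From this [n] on, [chain_primes] leaves no gap for [k]; for [8 <= k] it is
   the bound on [n] given by [2 ^ k <= 2 * n + 1]. *)
Definition chain_start (k : nat) : N :=
  nth (2 ^ N.of_nat k.-1)%num [:: 0; 2; 8; 13; 25; 50; 61; 72]%num k.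

Definition row_ok (n : nat) (r : seq N) : bool :=
  all (fun k => [|| (chain_start k <=? N.of_nat n)%num, (n < k)%N,
         (nth 0 r k <? head 0 r)%num | ~~ (nth 0 r k mod head 0 r =? 0)%num])
      (iota 1 7).

Fixpoint rows_ok (fuel n : nat) (r : seq N) : bool :=
  if fuel is f.+1 then
    row_ok n r && rows_ok f n.+1 (oddrow_step (1 + 2 * N.of_nat n) r)
  else true.

Lemma rows_okP fuel n m : rows_ok fuel n (oddrow n) -> (n <= m < n + fuel)%N ->
  row_ok m (oddrow m).
Proof.
elim: fuel n => [|f IHf] n /=; first by lia.
case/andP=> ok_n /(IHf n.+1) IH lt_m.
by have [<- //|ne_nm] := eqVneq n m; apply: IH; lia.
Qed.

(** Rows 2 to 71 suffice, since [chain_start k] is at most 72 for [k < 8]. *)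
Lemma rows_ok_start : rows_ok 70 2 (oddrow 2).
Proof. by vm_compute. Qed.

Lemma not_dvdn_oddcoef_small n k : (1 < n)%N -> (0 < k < 8)%N -> (k <= n)%N ->
    (n < N.to_nat (chain_start k))%N ->
  ~~ (oddcoef n 0 %| oddcoef n k)%N.
Proof.
move=> n_gt1 /andP[k_gt0 lt_k8] le_kn lt_n.
have lt_n72 : (n < 2 + 70)%N.
  by apply: leq_trans lt_n _; move: k k_gt0 lt_k8 {le_kn}; do 8?case.
have n_bnd : (1 < n < 2 + 70)%N by rewrite n_gt1.
have /allP/(_ k) := rows_okP rows_ok_start n_bnd.
rewrite mem_iota k_gt0 lt_k8 => /(_ isT).
have := nth_oddrow n lt_k8; have := @nth_oddrow n 0 isT; rewrite nth0 => <- <-.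
set c := nth _ _ _; set d := head _ _.
case/or4P => [||lt_cd|]; first lia; first lia.
  apply/negP => /dvdn_leq; have := @nth_oddrow n k lt_k8; rewrite -/c.
  by have := oddcoef_gt0 le_kn; lia.
apply: contra => /dvdnP[q Dc].
have -> : c = (N.of_nat q * d)%num by lia.
by rewrite N.Div0.mod_mul.
Qed.

(** One list serves every [k <= 22]: the windows of successive primes leave no gap when their ratio
    is at most about [(2k + 3) / (2k - 1)]. *)
Definition chain_primes : seq N :=
  [:: 3; 5; 7; 11; 13; 17; 19; 23; 29; 31; 37; 43; 53; 61; 73; 83; 97; 113; 131;
      151; 173; 199; 233; 271; 317; 367; 421; 487; 563; 601; 683; 773; 887;
      1013; 1129; 1283; 1459; 1657; 1879; 2113; 2383; 2689; 3023; 3413; 3853;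
      3967; 4447; 4973; 5573; 6247; 7001; 7489; 8329; 9277; 10337; 11503; 12809;
      14159; 15683; 17377; 19249; 21323; 23627; 26177; 26881; 29633; 32653;
      35999; 39679; 43721; 48197; 51137; 56123; 61583; 67589; 74177; 81409;
      89329; 97523; 106591; 116491; 127321]%num.

Lemma chain_primesP : all odd_primeN chain_primes.
Proof. by vm_compute. Qed.

(* Beyond this [n], [not_dvdn_oddcoef_large] applies with [t := 7], as
   [4 * k <= 2 ^ 7] for [k <= 22]. *)
Definition chain_end (k : nat) : N :=
  let k := N.of_nat k in (2 * k * (14 * (9 * k * k + 3 * k) + 2113))%num.

Lemma chains_ok :
  all (fun k => chain (N.of_nat k) (chain_start k) (chain_end k) chain_primes)
      (iota 1 22).
Proof. by vm_compute. Qed.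

(** The exponent [k - 16] is 7 at [k = 23], where 92 <= 2^7, and increases with [k], so that the
    induction compares a quartic with a doubling. At [k = 22] the second bound would fail even with
    exponent 7. *)
Lemma exp2_ge_quartic k : (23 <= k)%N -> (4 * k <= 2 ^ (k - 16))%N /\
  (2 * k * (2 * ((k - 16) * (9 * k ^ 2 + 3 * k)) + 2113) <= 2 ^ k.-1)%N.
Proof.
elim: k => // k IHk; rewrite leq_eqVlt => /predU1P[<-|lt_k].
  split; first by [].
  (* Splitting the power avoids evaluating 2^22 in unary. *)
  have -> : 23.-1 = (11 + 11)%N by [].
  by rewrite expnD -[(2 ^ 11)%N]/2048%N -[(23 - 16)%N]/7%N -[(23 ^ 2)%N]/529%N; lia.
have [] := IHk lt_k; have -> : (k.+1 - 16 = (k - 16).+1)%N by lia.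
have [j ->] : exists j, k = (j + 23)%N by exists (k - 23)%N; lia.
have -> : (j + 23 - 16 = j + 7)%N by lia.
have -> : (j + 23).-1 = (j + 22)%N by lia.
have -> : (j + 23).+1.-1 = (j + 22).+1 by lia.
rewrite [(2 ^ (j + 7).+1)%N]expnS [(2 ^ (j + 22).+1)%N]expnS.
move: (2 ^ (j + 7))%N (2 ^ (j + 22))%N => x y; rewrite -!mulnn.
by split; [lia | nia].
Qed.

Lemma not_dvdn_oddcoef n k : (1 < n)%N -> (0 < k <= n)%N ->
  ~~ (oddcoef n 0 %| oddcoef n k)%N.
Proof.
move=> n_gt1 /andP[k_gt0 le_kn]; apply/negP => dvd_n.
have le_2k := exp2_le_of_dvd le_kn dvd_n.
have le_2k' : (2 ^ k.-1 <= n)%N.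
  by move: le_2k; case: k k_gt0 {le_kn dvd_n} => //= k _; rewrite expnS; lia.
have large t : (4 * k <= 2 ^ t)%N ->
    (2 * k * (2 * (t * (9 * k ^ 2 + 3 * k)) + 2113) <= n)%N -> False.
  move=> le_t le_n; apply: (negP _ dvd_n).
  have le_N : (2 * (t * (9 * k ^ 2 + 3 * k)) + 2113 <= n %/ (2 * k))%N.
    by rewrite leq_divRL ?muln_gt0 // mulnC.
  by apply: (not_dvdn_oddcoef_large k_gt0 le_t); lia.
(* Above 22, the bound [2 ^ k.-1 <= n] alone makes [n] large enough; up to 22, [chain_start] and
   [chain_end] delimit three ranges of [n]. *)
have [lt_k|le_k] := ltnP 22 k.
  have [le_t le_n] := exp2_ge_quartic lt_k.
  by apply: (large (k - 16)%N) => //; apply: leq_trans le_n le_2k'.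
have [le_n|lt_n] := leqP (N.to_nat (chain_end k)) n.
  apply: (large 7%N); first by rewrite (@leq_trans 88) // (leq_mul2l 4 k 22).
  by move: le_n; rewrite /chain_end -mulnn; lia.
have [lt_n'|le_n] := ltnP n (N.to_nat (chain_start k)).
  have [lt_k8|le_8k] := ltnP k 8.
    by have := @not_dvdn_oddcoef_small n k; rewrite k_gt0 lt_k8 dvd_n => /(_ n_gt1 isT le_kn lt_n').
  (* For [k >= 8] the default value [2 ^ k.-1] applies, contradicting [le_2k']. *)
  move: lt_n'; rewrite /chain_start nth_default // => lt_n'.
  have Dexp j : N.to_nat (2 ^ N.of_nat j) = (2 ^ j)%N.
    by elim: j => // j IHj; rewrite Nat2N.inj_succ N.pow_succ_r' expnS -IHj; lia.
  by rewrite Dexp in lt_n'; lia.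
have /allP/(_ k) := chains_ok; rewrite mem_iota k_gt0 ltnS le_k => /(_ isT) k_chain.
have k_gt0N : (0 < N.of_nat k)%num by lia.
have := chainP k_gt0N chain_primesP k_chain; rewrite Nat2N.id => /(_ n).
by rewrite le_n lt_n dvd_n => /(_ isT).
Qed.

Theorem theorem3p1 (n k : nat) (hn : (1 < n)%N) (hk : (1 <= k <= n)%N) :
  esym_odd_recip k n \isn't a Num.int.
Proof. exact: contra (@esym_odd_recip_int k n) (not_dvdn_oddcoef hn hk). Qed.
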